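(* Let $a>0$ and let $f_a,g_a:\mathbb{R}^2\to\mathbb{R}$ be given by $f_a(x,y)=(x^2+y^2)^2-2a^2(x^2-y^2)$ and $g_a(x,y)=(x^2+y^2)^2+2a^2(x^2-y^2)$. For every $b\geq 16a^8$ the level curve $(f_ag_a)^{-1}(b)$ of the product $f_ag_a$ is convex, and $(f_ag_a)^{-1}(16a^8)$ is the first convex level curve of $f_ag_a$ among the levels $b>0$, i.e. $(f_ag_a)^{-1}(b)$ is not convex for $0<b<16a^8$.
   Context: A level set $F^{-1}(b)$ of a function $F:\mathbb{R}^2\to\mathbb{R}$ is said to be convex if it bounds a convex sublevel set, i.e. if the sublevel set $F^{-1}((-\infty,b])$ is a convex subset of $\mathbb{R}^2$. *)

(* Defs.v *)
From mathcomp Require Import all_boot all_order all_algebra.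
From mathcomp Require Import boolp classical_sets set_interval reals.
From mathcomp Require Import interval_inference convex.

Set Implicit Arguments.
Unset Strict Implicit.
Unset Printing Implicit Defensive.

Import Order.TTheory GRing.Theory Num.Theory.

Local Open Scope classical_set_scope.
Local Open Scope ring_scope.

(* [R^o] rather than [R], so that the product carries the canonical lmodType
   structure over R with respect to which [convex_set] is stated. *)
Definition plane (R : realType) : lmodType R := (R^o * R^o)%type.

Definition sublevel_set (R : realType) (F : plane R -> R) (b : R) :
  set (plane R) := F @^-1` [set` `]-oo, b]].

(* Convexity of the level set F^-1(b). It refers to the region F <= b bounded
   by the level set, not to F^-1(b) itself; hence the predicate takes the pair
   (F, b) and not the bare set F^-1(b). *)
Definition convex_level_set (R : realType) (F : plane R -> R) (b : R) : Prop :=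
  convex_set (sublevel_set F b).

Definition f (R : realType) (a : R) (p : plane R) : R :=
  let: (x, y) := p in
  (x ^+ 2 + y ^+ 2) ^+ 2 - 2 * a ^+ 2 * (x ^+ 2 - y ^+ 2).

Definition g (R : realType) (a : R) (p : plane R) : R :=
  let: (x, y) := p in
  (x ^+ 2 + y ^+ 2) ^+ 2 + 2 * a ^+ 2 * (x ^+ 2 - y ^+ 2).

(* Main.v *)
(** Put [X = (x^2+y^2)^2], [D = (x^2-y^2)^2] and [A = a^4], so that the product
    of the two functions is [X^2 - 4AD].
    For [b >= 16 A^2], suppose that the sublevel set misses a point [m] between
    two of its points and let [s] be the value of [X] at [m]; then [s > 4A].
    As [X^2 >= 2sX - s^2] with equality at [m], it is enough that [sX - 2AD] is
    a convex function. It is, since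
      [sX - 2AD = (s-4A)(x^2+y^2)^2 + A((x+y)^4 + (x-y)^4)].
    For [0 < b < 16 A^2], the boundary point of the sublevel set on the diagonal
    [x = y] is a strict dent: a point slightly further out on the diagonal is
    outside, and is the midpoint of two points inside. *)
Require Import Defs.
From mathcomp Require Import all_boot all_order all_algebra.
From mathcomp Require Import boolp classical_sets set_interval reals.
From mathcomp Require Import interval_inference convex.
From mathcomp Require Import ring lra.

Import Order.TTheory GRing.Theory Num.Theory.
Local Open Scope ring_scope.

Lemma fgE (R : realType) (a x y : R) :
  (f a \* g a) (x, y) =
  ((x ^+ 2 + y ^+ 2) ^+ 2) ^+ 2 - 4 * a ^+ 4 * (x ^+ 2 - y ^+ 2) ^+ 2.
Proof. rewrite /f /g /=; ring. Qed.

Section PowerConvexity.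
Variable R : realFieldType.
Implicit Types s t x y z u v A : R.

Lemma sqr_conv_le t x y : 0 <= t <= 1 ->
  (t * x + (1 - t) * y) ^+ 2 <= t * x ^+ 2 + (1 - t) * y ^+ 2.
Proof.
move=> /andP[t0 t1]; rewrite -subr_ge0.
rewrite [leRHS](_ : _ = t * (1 - t) * (x - y) ^+ 2); last by ring.
by rewrite mulr_ge0 ?sqr_ge0// mulr_ge0 ?subr_ge0.
Qed.

(** Squaring is monotone on nonnegative numbers, so [sqr_conv_le] can be iterated: this yields both
    the fourth powers and the squared norm. *)
Lemma sqr_le_conv t x y z : 0 <= t <= 1 -> 0 <= z ->
  z <= t * x + (1 - t) * y -> z ^+ 2 <= t * x ^+ 2 + (1 - t) * y ^+ 2.
Proof.
move=> t01 z0 zxy; apply: le_trans (sqr_conv_le _ x y t01).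
by rewrite lerXn2r ?nnegrE// (le_trans z0).
Qed.

Lemma pow4_conv_le t x y : 0 <= t <= 1 ->
  (t * x + (1 - t) * y) ^+ 4 <= t * x ^+ 4 + (1 - t) * y ^+ 4.
Proof.
move=> t01; rewrite !(exprM _ 2 2).
by apply: sqr_le_conv; rewrite ?sqr_ge0 ?sqr_conv_le.
Qed.

Lemma normsq_sqr_conv_le t x y u v : 0 <= t <= 1 ->
  ((t * x + (1 - t) * u) ^+ 2 + (t * y + (1 - t) * v) ^+ 2) ^+ 2 <=
  t * (x ^+ 2 + y ^+ 2) ^+ 2 + (1 - t) * (u ^+ 2 + v ^+ 2) ^+ 2.
Proof.
move=> t01; apply: sqr_le_conv => //; first by rewrite addr_ge0 ?sqr_ge0.
have := sqr_conv_le _ x u t01; have := sqr_conv_le _ y v t01; lra.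
Qed.

(** Half of the tangent [2sX - s^2 - 4AD] to [X^2 - 4AD] at [X = s], with the constant dropped. *)
Definition tangent_quartic A s x y : R :=
  s * (x ^+ 2 + y ^+ 2) ^+ 2 - 2 * A * (x ^+ 2 - y ^+ 2) ^+ 2.

Lemma tangent_quarticE A s x y : tangent_quartic A s x y =
  (s - 4 * A) * (x ^+ 2 + y ^+ 2) ^+ 2 + A * ((x + y) ^+ 4 + (x - y) ^+ 4).
Proof. by rewrite /tangent_quartic; ring. Qed.

Lemma tangent_quartic_conv_le A s t x y u v :
  0 <= A -> 4 * A <= s -> 0 <= t <= 1 ->
  tangent_quartic A s (t * x + (1 - t) * u) (t * y + (1 - t) * v) <=
  t * tangent_quartic A s x y + (1 - t) * tangent_quartic A s u v.
Proof.
move=> A0 As t01; rewrite !tangent_quarticE.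
have r4 := normsq_sqr_conv_le _ x y u v t01.
have p4 := pow4_conv_le _ (x + y) (u + v) t01.
have m4 := pow4_conv_le _ (x - y) (u - v) t01.
have -> : t * x + (1 - t) * u + (t * y + (1 - t) * v) =
  t * (x + y) + (1 - t) * (u + v) by ring.
have -> : t * x + (1 - t) * u - (t * y + (1 - t) * v) =
  t * (x - y) + (1 - t) * (u - v) by ring.
have sA0 : 0 <= s - 4 * A by rewrite subr_ge0.
have h1 := ler_wpM2l sA0 r4.
have h2 := ler_wpM2l A0 (lerD p4 m4).
by apply: le_trans (lerD h1 h2) _; rewrite le_eqVlt; apply/orP/or_introl/eqP; ring.
Qed.

End PowerConvexity.

Lemma fg_conv_le (R : realType) (a b t x y u v : R) :
  16 * a ^+ 8 <= b -> 0 <= t <= 1 ->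
  (f a \* g a) (x, y) <= b -> (f a \* g a) (u, v) <= b ->
  (f a \* g a) (t * x + (1 - t) * u, t * y + (1 - t) * v) <= b.
Proof.
move=> ab t01; rewrite !fgE => Fp Fq; rewrite leNgt; apply/negP => Fm.
set s := ((t * x + (1 - t) * u) ^+ 2 + (t * y + (1 - t) * v) ^+ 2) ^+ 2 in Fm.
have A0 : 0 <= a ^+ 4 by rewrite (exprM _ 2 2) sqr_ge0.
have s0 : 0 <= s by exact: sqr_ge0.
(* Compare squares: [(4 * a ^+ 4) ^+ 2 <= b], and [b < s ^+ 2] because the subtracted term in [Fm]
   is nonnegative. *)
have As : 4 * a ^+ 4 <= s.
  have A40 : 0 <= 4 * a ^+ 4 by rewrite mulr_ge0.
  rewrite -(@ler_pXn2r _ 2)//.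
  apply: (@le_trans _ _ b); first by move: ab; congr (_ <= _); ring.
  apply: (le_trans (ltW Fm)).
  by rewrite gerBl; apply: mulr_ge0 A40 (sqr_ge0 _).
have := tangent_quartic_conv_le _ _ _ _ x y u v A0 As t01.
rewrite /tangent_quartic -/s.
set P := (x ^+ 2 + y ^+ 2) ^+ 2 in Fp *.
set Q := (u ^+ 2 + v ^+ 2) ^+ 2 in Fq *.
set DP := (x ^+ 2 - y ^+ 2) ^+ 2 in Fp *.
set DQ := (u ^+ 2 - v ^+ 2) ^+ 2 in Fq *.
have [t0 t1] := andP t01.
(* From [2sP <= s^2 + P^2] and [Fp]. *)
have tanP : 2 * (s * P - 2 * a ^+ 4 * DP) <= b + s ^+ 2.
  by have := sqr_ge0 (s - P); nra.
have tanQ : 2 * (s * Q - 2 * a ^+ 4 * DQ) <= b + s ^+ 2.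
  by have := sqr_ge0 (s - Q); nra.
have := ler_wpM2l t0 tanP.
have : 0 <= 1 - t by rewrite subr_ge0.
move=> /ler_wpM2l/(_ _ _ tanQ).
(* The tangent is exact at the missed point, so [Fm] puts twice the quartic there above [b + s^2],
   against [tanP] and [tanQ]. *)
move: Fm; rewrite expr2; lra.
Qed.

(* In the coordinates [x = u + v], [y = u - v], with [t = u^2] and [s = v^2],
   the product is [16 ((t + s)^4 - 4Ats)], so [w] stands for the diagonal
   boundary point. *)
Lemma diagonal_dent (R : realFieldType) (A w : R) : 0 < w -> w ^+ 2 < A ->
  exists t s : R, [/\ 0 <= t, 0 <= s, w ^+ 4 < t ^+ 4 &
    (t + s) ^+ 4 - 4 * A * t * s <= w ^+ 4].
Proof.
move=> w0 wA; set c := A - w ^+ 2; set B := A + w ^+ 2.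
have c0 : 0 < c by rewrite subr_gt0.
have w20 : 0 < w ^+ 2 by rewrite exprn_gt0.
have A0 : 0 < A by exact: lt_trans wA.
have B0 : 0 < B by rewrite addr_gt0.
(* Along [(t, s) = (w + ce, 2w^2 e)] the sum [t + s] is [w + Be], and the first-order term of
   [(t + s)^4 - 4Ats] is [-4w^3 ce < 0]. This [e] is small enough for that term to win. *)
pose e := w * c / (3 * B ^+ 2).
have e0 : 0 < e by rewrite divr_gt0 ?mulr_gt0// ?exprn_gt0.
exists (w + c * e), (2 * w ^+ 2 * e).
have ce0 : 0 < c * e by rewrite mulr_gt0.
split.
- by rewrite addr_ge0 ?ltW.
- by rewrite ltW// mulr_gt0// mulr_gt0.
- by rewrite ltrXn2r ?nnegrE ?addr_ge0 ?ltW// ltrDl.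
pose n := B * e.
have nE : 3 * B * n = w * c.
  by rewrite /n /e; field; rewrite gt_eqF.
have n0 : 0 < n by rewrite mulr_gt0.
have nw : n <= w.
  have cB : c <= B by rewrite /c /B; lra.
  rewrite -(@ler_pM2l _ (3 * B)) ?mulr_gt0// nE mulrC ler_wpM2r ?ltW//; lra.
have -> : w + c * e + 2 * w ^+ 2 * e = w + n by rewrite /n /c /B; ring.
have n2w2 : 4 * w * n ^+ 3 + n ^+ 4 <= 5 * (w ^+ 2 * n ^+ 2).
  have nn : n ^+ 2 <= w * n by rewrite expr2 ler_wpM2r// ltW.
  have nnw : n ^+ 2 <= w ^+ 2 by rewrite lerXn2r ?nnegrE// ltW.
  have n20 : 0 <= n ^+ 2 by rewrite sqr_ge0.
  have := ler_wpM2r n20 nn; have := ler_wpM2r n20 nnw.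
  have := ler_wpM2l (ltW w0) (ler_wpM2r (ltW n0) nn).
  nra.
(* The higher-order terms of [(w + n)^4] cost at most [(6 + 5) w^2 n^2], while the choice of [e]
   makes the first-order gain [12 w^2 n^2]. *)
have main : 11 * (w ^+ 2 * n ^+ 2) <= 4 * w ^+ 3 * (c * e).
  have -> : 4 * w ^+ 3 * (c * e) = 4 * w ^+ 2 * e * (w * c) by ring.
  rewrite -nE.
  have -> : 4 * w ^+ 2 * e * (3 * B * n) = 12 * (w ^+ 2 * n ^+ 2).
    by rewrite /n; ring.
  by have := mulr_ge0 (sqr_ge0 w) (sqr_ge0 n); lra.
have rest : 0 <= 8 * A * w ^+ 2 * c * e ^+ 2.
  by rewrite mulr_ge0 ?sqr_ge0// ltW// mulr_gt0// mulr_gt0// mulr_gt0.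
have -> : 4 * A * (w + c * e) * (2 * w ^+ 2 * e) =
  4 * w ^+ 3 * n + 4 * w ^+ 3 * (c * e) + 8 * A * w ^+ 2 * c * e ^+ 2.
  by rewrite /n /c /B; ring.
have -> : (w + n) ^+ 4 = w ^+ 4 + 4 * w ^+ 3 * n + 6 * (w ^+ 2 * n ^+ 2)
  + (4 * w * n ^+ 3 + n ^+ 4) by ring.
lra.
Qed.

Lemma fg_not_midconvex (R : realType) (a b : R) :
  0 < a -> 0 < b -> b < 16 * a ^+ 8 ->
  exists u v : R, [/\ (f a \* g a) (u + v, u - v) <= b,
    (f a \* g a) (u - v, u + v) <= b & b < (f a \* g a) (u, u)].
Proof.
(* At [(u, u)] the product is [16 t^4] with [t = u^2], so it equals [b] at [t = w]. *)
move=> a0 b0 ba; pose w := Num.sqrt (Num.sqrt (b / 16)).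
have b160 : 0 < b / 16 by rewrite divr_gt0.
have w0 : 0 < w by rewrite !sqrtr_gt0.
have w2 : w ^+ 2 = Num.sqrt (b / 16) by rewrite sqr_sqrtr ?sqrtr_ge0.
have w4 : w ^+ 4 = b / 16 by rewrite (exprM _ 2 2) w2 sqr_sqrtr ?ltW.
have wA : w ^+ 2 < a ^+ 4.
  rewrite -(@ltr_pXn2r _ 2) ?nnegrE ?exprn_ge0 ?ltW// -!exprM w4.
  by rewrite ltr_pdivrMr// mulrC.
have [t [s [t0 s0 wt ts]]] := @diagonal_dent _ _ _ w0 wA.
exists (Num.sqrt t), (Num.sqrt s); rewrite !fgE.
have := sqr_sqrtr t0; have := sqr_sqrtr s0.
move: (Num.sqrt t) (Num.sqrt s) => u v vs ut.
rewrite -{}vs -{}ut in wt ts *; rewrite w4 in wt ts.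
split.
- have -> : ((((u + v) ^+ 2 + (u - v) ^+ 2) ^+ 2) ^+ 2 -
    4 * a ^+ 4 * ((u + v) ^+ 2 - (u - v) ^+ 2) ^+ 2) =
    16 * ((u ^+ 2 + v ^+ 2) ^+ 4 - 4 * a ^+ 4 * u ^+ 2 * v ^+ 2) by ring.
  lra.
- have -> : ((((u - v) ^+ 2 + (u + v) ^+ 2) ^+ 2) ^+ 2 -
    4 * a ^+ 4 * ((u - v) ^+ 2 - (u + v) ^+ 2) ^+ 2) =
    16 * ((u ^+ 2 + v ^+ 2) ^+ 4 - 4 * a ^+ 4 * u ^+ 2 * v ^+ 2) by ring.
  lra.
- have -> : ((u ^+ 2 + u ^+ 2) ^+ 2) ^+ 2 -
    4 * a ^+ 4 * (u ^+ 2 - u ^+ 2) ^+ 2 = 16 * (u ^+ 2) ^+ 4 by ring.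
  lra.
Qed.

Lemma mem_sublevel_set (R : realType) (F : plane R -> R) (b : R) (p : plane R) :
  (p \in sublevel_set F b) = (F p <= b).
Proof. by apply/idP/idP; rewrite inE /sublevel_set /= in_itv. Qed.

Theorem mainTheorem9 (R : realType) (a : R) (ha : 0 < a) :
  (forall b : R, 16 * a ^+ 8 <= b -> convex_level_set (f a \* g a) b) /\
  (forall b : R, 0 < b -> b < 16 * a ^+ 8 ->
     ~ convex_level_set (f a \* g a) b).
Proof.
split=> [b ab [x y] [u v] t|b b0 ba cvx].
  rewrite !mem_sublevel_set => Fp Fq.
  by apply: fg_conv_le => //; apply/andP; split.
have [u [v [Fp Fq Fm]]] := @fg_not_midconvex _ _ _ ha b0 ba.
have h0 : 0 <= 2^-1 :> R by rewrite invr_ge0.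
have h1 : 2^-1 <= 1 :> R by rewrite invf_le1// ler1n.
rewrite -!mem_sublevel_set in Fp Fq.
(* The two points are mirror images in the diagonal; their midpoint is [(u, u)]. *)
have Fc : ((2^-1 * (u + v) + (1 - 2^-1) * (u - v),
            2^-1 * (u - v) + (1 - 2^-1) * (u + v)) : plane R)
    \in sublevel_set (f a \* g a) b := cvx _ _ (Itv01 h0 h1) Fp Fq.
move: Fc; rewrite mem_sublevel_set leNgt => /negP; apply.
by move: Fm; congr (b < _ (_, _)); lra.
Qed.
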